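(* Let $\mathbb A$ be a distributive monoidal category and let $\mathbf H\,\ulcorner\mathbb A\urcorner^{\oplus}$ be the category of horizontal cells of its free cornering with choice. Then in $\mathbf H\,\ulcorner\mathbb A\urcorner^{\oplus}$: (i) for all objects $A,B$ of $\mathbb A$, $(A\oplus B)^\circ\cong A^\circ+B^\circ$ and $(A\oplus B)^\bullet\cong A^\bullet\times B^\bullet$; (ii) for all exchanges $U,V,W\in\mathbb A^{\circ\bullet}_\oplus$, $(U\times V)\times W\cong U\times(V\times W)$ and $(U+V)+W\cong U+(V+W)$.
   Context: Monoidal categories are strict, and composites are in diagrammatic order ($fg$ is first $f$, then $g$). A single-object double category $\mathbb D$ has a horizontal edge monoid $(\mathbb D_H,\otimes,I)$, a vertical edge monoid $(\mathbb D_V,\otimes,I)$, and for $A,B\in\mathbb D_H$, $U,W\in\mathbb D_V$ a set of cells $(U;A;B;W)$ (left; top; bottom; right boundary). For $\alpha:(U;A;B;V)$ and $\beta:(V;A';B';W)$ there is a horizontal composite $\alpha\mid\beta:(U;A\otimes A';B\otimes B';W)$; for $\alpha:(U;A;C;W)$ and $\beta:(U';C;B;W')$ a vertical composite $\frac{\alpha}{\beta}:(U\otimes U';A;B;W\otimes W')$. Both are associative and unital, with horizontal units $id_U:(U;I;I;U)$ and vertical units $1_A:(I;A;A;I)$, where $id_I=1_I$, $1_{A\otimes B}=1_A\mid 1_B$, $id_{U\otimes W}=\frac{id_U}{id_W}$, and interchange $\frac{\alpha}{\beta}\mid\frac{\gamma}{\delta}=\frac{\alpha\mid\gamma}{\beta\mid\delta}$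 holds. $\mathbf H\,\mathbb D$ is the monoidal category with objects the elements of $\mathbb D_V$, morphisms $U\to W$ the cells $(U;I;I;W)$, composition $\mid$, and tensor given by vertical composition. A distributive monoidal category $(\mathbb A,\otimes,\oplus,I)$ is a symmetric monoidal category with binary coproducts $A\oplus B$ (injections $\sigma_0,\sigma_1$, copairing $[f,g]$; no initial object required) such that $[\sigma_0\otimes 1_C,\sigma_1\otimes 1_C]:(A\otimes C)\oplus(B\otimes C)\to(A\oplus B)\otimes C$ is invertible for all $A,B,C$. Exchanges with choice: $\mathbb A^{\circ\bullet}_\oplus$ is the monoid (operation $\otimes$, unit $I$) with elements generated by $A^\circ$, $A^\bullet$ ($A\in\mathbb A_0$), $I$, $U\otimes W$, $U\times W$, $U+W$, subject only to associativity and unitality of $\otimes$. Free cornering with choice: $\ulcorner\mathbb A\urcorner^{\oplus}$ is the free single-object double category with horizontal edge monoid $(\mathbb A_0,\otimes,I)$, vertical edge monoid $\mathbb A^{\circ\bullet}_\oplus$, and generating cells and equations: (1) for each $f:A\to B$ in $\mathbb A$ a cell $\ulcorner f\urcorner:(I;A;B;I)$ (also written $f$), with $\ulcorner fg\urcorner=\frac{\ulcorner f\urcorner}{\ulcorner g\urcorner}$, $\ulcorner 1_A\urcorner=1_A$, $\ulcorner f\otimes g\urcorner=\ulcorner f\urcorner\mid\ulcorner g\urcorner$; (2) for each $A\in\mathbb A_0$ corner cells $\mathsf{get}_L^A:(A^\circ;I;A;I)$, $\mathsf{put}_R^A:(I;A;I;A^\circ)$, $\mathsf{get}_R^A:(I;I;A;A^\bullet)$,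 $\mathsf{put}_L^A:(A^\bullet;A;I;I)$ with $\mathsf{put}_R^A\mid\mathsf{get}_L^A=1_A$, $\frac{\mathsf{get}_L^A}{\mathsf{put}_R^A}=id_{A^\circ}$, $\mathsf{get}_R^A\mid\mathsf{put}_L^A=1_A$, $\frac{\mathsf{get}_R^A}{\mathsf{put}_L^A}=id_{A^\bullet}$; (3) for all $U,W$, cells $\pi_0:(U\times W;I;I;U)$, $\pi_1:(U\times W;I;I;W)$, and for $\alpha:(V;A;B;U)$, $\beta:(V;A;B;W)$ a unique cell $\alpha\times\beta:(V;A;B;U\times W)$ with $(\alpha\times\beta)\mid\pi_0=\alpha$, $(\alpha\times\beta)\mid\pi_1=\beta$; (4) for all $U,W$, cells $\iota_0:(U;I;I;U+W)$, $\iota_1:(W;I;I;U+W)$, and for $\alpha:(U;A;B;V)$, $\beta:(W;A;B;V)$ a unique cell $\alpha+\beta:(U+W;A;B;V)$ with $\iota_0\mid(\alpha+\beta)=\alpha$, $\iota_1\mid(\alpha+\beta)=\beta$; (5) for $\alpha:(U;A;C;W)$, $\beta:(U;B;C;W)$ a unique cell $[\alpha,\beta]:(U;A\oplus B;C;W)$ with $\frac{\ulcorner\sigma_0\urcorner}{[\alpha,\beta]}=\alpha$, $\frac{\ulcorner\sigma_1\urcorner}{[\alpha,\beta]}=\beta$. *)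

(* Defs.v *)
From mathcomp Require Import all_boot.
From mathcomp Require Import boolp.

Set Implicit Arguments.
Unset Strict Implicit.
Unset Printing Implicit Defensive.

(* Since monoidal structures are strict, the two sides of laws such as
   (f (x) g) (x) h = f (x) (g (x) h) live in types that are only propositionally
   equal.  Such laws are stated as equalities between elements bundled with
   their boundaries ([tot2], [tot4]). *)
Definition tot2 (T : Type) (F : T -> T -> Type) (x y : T) (f : F x y) :
    {p : T * T & F p.1 p.2} :=
  existT (fun p => F p.1 p.2) (x, y) f.

Definition tot4 (V H : Type) (F : V -> H -> H -> V -> Type) (u : V) (a b : H)
    (w : V) (c : F u a b w) :
    {p : V * H * H * V & F p.1.1.1 p.1.1.2 p.1.2 p.2} :=
  existT (fun p : V * H * H * V => F p.1.1.1 p.1.1.2 p.1.2 p.2) (u, a, b, w) c.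

Notation "f =2= g" := (tot2 f = tot2 g) (at level 70, no associativity).
Notation "f =4= g" := (tot4 f = tot4 g) (at level 70, no associativity).

(* [comp] is in diagrammatic order. *)
Record strict_monoidal_category := StrictMonoidalCategory {
  ob :> Type;
  tunit : ob;
  tens : Monoid.law tunit;
  hom : ob -> ob -> Type;
  idm : forall X, hom X X;
  comp : forall X Y Z, hom X Y -> hom Y Z -> hom X Z;
  tensm : forall X Y X' Y',
    hom X Y -> hom X' Y' -> hom (tens X X') (tens Y Y');
  comp1m : forall X Y (f : hom X Y), comp (idm X) f = f;
  compm1 : forall X Y (f : hom X Y), comp f (idm Y) = f;
  compA : forall X Y Z T (f : hom X Y) (g : hom Y Z) (h : hom Z T),
    comp (comp f g) h = comp f (comp g h);
  tensm_id : forall X Y, tensm (idm X) (idm Y) = idm (tens X Y);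
  tensm_comp : forall X Y Z X' Y' Z' (f : hom X Y) (g : hom Y Z)
      (f' : hom X' Y') (g' : hom Y' Z'),
    tensm (comp f g) (comp f' g') = comp (tensm f f') (tensm g g');
  tens1m : forall X Y (f : hom X Y), tensm (idm tunit) f =2= f;
  tensm1 : forall X Y (f : hom X Y), tensm f (idm tunit) =2= f;
  tensmA : forall X Y X' Y' X'' Y''
      (f : hom X Y) (g : hom X' Y') (h : hom X'' Y''),
    tensm (tensm f g) h =2= tensm f (tensm g h)
}.

Arguments tunit {s}.
Arguments tens {s}.
Arguments hom {s}.
Arguments idm {s}.

Definition eqm (C : strict_monoidal_category) (X Y : C) (e : X = Y) : hom X Y :=
  eq_rect X (hom X) (idm X) Y e.

Definition isomorphic (C : strict_monoidal_category) (X Y : C) : Prop :=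
  exists (f : hom X Y) (g : hom Y X), comp f g = idm X /\ comp g f = idm Y.

Definition assoc (C : strict_monoidal_category) (X Y Z : C) :
    hom (tens (tens X Y) Z) (tens X (tens Y Z)) :=
  eqm (esym (Monoid.mulmA tens X Y Z)).

Definition assoc_inv (C : strict_monoidal_category) (X Y Z : C) :
    hom (tens X (tens Y Z)) (tens (tens X Y) Z) :=
  eqm (Monoid.mulmA tens X Y Z).

Record symmetric_monoidal_category := SymmetricMonoidalCategory {
  smc_base :> strict_monoidal_category;
  braid : forall X Y : smc_base, hom (tens X Y) (tens Y X);
  braid_nat : forall (X X' Y Y' : smc_base) (f : hom X X') (g : hom Y Y'),
    comp (tensm f g) (braid X' Y') = comp (braid X Y) (tensm g f);
  braidK : forall X Y, comp (braid X Y) (braid Y X) = idm (tens X Y);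
  braid_hexagon : forall X Y Z,
    comp (comp (assoc X Y Z) (braid X (tens Y Z))) (assoc Y Z X) =
    comp (comp (tensm (braid X Y) (idm Z)) (assoc Y X Z))
         (tensm (idm Y) (braid X Z))
}.

Record distributive_monoidal_category := DistributiveMonoidalCategory {
  dmc_base :> symmetric_monoidal_category;
  oplus : dmc_base -> dmc_base -> dmc_base;
  sigma0 : forall X Y, hom X (oplus X Y);
  sigma1 : forall X Y, hom Y (oplus X Y);
  copair : forall X Y Z : dmc_base, hom X Z -> hom Y Z -> hom (oplus X Y) Z;
  copair0 : forall X Y Z (f : hom X Z) (g : hom Y Z),
    comp (sigma0 X Y) (copair f g) = f;
  copair1 : forall X Y Z (f : hom X Z) (g : hom Y Z),
    comp (sigma1 X Y) (copair f g) = g;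
  copair_uniq : forall X Y Z (f : hom X Z) (g : hom Y Z) (h : hom (oplus X Y) Z),
    comp (sigma0 X Y) h = f -> comp (sigma1 X Y) h = g -> h = copair f g;
  distributive : forall X Y Z : dmc_base,
    let dist : hom (oplus (tens X Z) (tens Y Z)) (tens (oplus X Y) Z) :=
      copair (tensm (sigma0 X Y) (idm Z)) (tensm (sigma1 X Y) (idm Z)) in
    exists dist' : hom (tens (oplus X Y) Z) (oplus (tens X Z) (tens Y Z)),
      comp dist dist' = idm (oplus (tens X Z) (tens Y Z)) /\
      comp dist' dist = idm (tens (oplus X Y) Z)
}.

(* There is a single object.  The boundary of a cell is listed in the order
   left, top, bottom, right. *)
Record double_category := DoubleCategory {
  hedge : Type;
  hI : hedge;
  hT : Monoid.law hI;
  vedge : Type;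
  vI : vedge;
  vT : Monoid.law vI;
  cell : vedge -> hedge -> hedge -> vedge -> Type;
  hcomp : forall U V W A A' B B',
    cell U A B V -> cell V A' B' W -> cell U (hT A A') (hT B B') W;
  vcomp : forall U U' W W' A B C,
    cell U A C W -> cell U' C B W' -> cell (vT U U') A B (vT W W');
  hid : forall U, cell U hI hI U;
  vid : forall A, cell vI A A vI;
  hcompA : forall U V W Z A A' A'' B B' B'' (a : cell U A B V)
      (b : cell V A' B' W) (c : cell W A'' B'' Z),
    hcomp (hcomp a b) c =4= hcomp a (hcomp b c);
  hcomp1c : forall U A B V (a : cell U A B V), hcomp (hid U) a =4= a;
  hcompc1 : forall U A B V (a : cell U A B V), hcomp a (hid V) =4= a;
  vcompA : forall U U' U'' W W' W'' A B C E (a : cell U A B W)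
      (b : cell U' B C W') (c : cell U'' C E W''),
    vcomp (vcomp a b) c =4= vcomp a (vcomp b c);
  vcomp1c : forall U A B V (a : cell U A B V), vcomp (vid A) a =4= a;
  vcompc1 : forall U A B V (a : cell U A B V), vcomp a (vid B) =4= a;
  hid_vid : hid vI = vid hI;
  vid_tens : forall A B, vid (hT A B) = hcomp (vid A) (vid B);
  hid_tens : forall U W, hid (vT U W) = vcomp (hid U) (hid W);
  interchange : forall U V W U' V' W' A B C A' B' C'
      (a : cell U A C V) (b : cell U' C B V')
      (c : cell V A' C' W) (d : cell V' C' B' W'),
    hcomp (vcomp a b) (vcomp c d) = vcomp (hcomp a c) (hcomp b d)
}.

Arguments hI {d0}.
Arguments hT {d0}.
Arguments vI {d0}.
Arguments vT {d0}.

Section HorizontalCells.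
Variable D : double_category.

Lemma tot4_inj (V H : Type) (F : V -> H -> H -> V -> Type) u a b w
  (c d : F u a b w) : c =4= d -> c = d.
Proof.
move=> e; move: (projT1_eq e) (projT2_eq e) => /= e1.
by rewrite (Prop_irrelevance e1 erefl).
Qed.

Lemma tot2_tot4 (V H : Type) (F : V -> H -> H -> V -> Type) a u w u' w'
  (c : F u a a w) (d : F u' a a w') :
  c =4= d -> tot2 (F := fun u w => F u a a w) c = tot2 d.
Proof.
rewrite /tot2 => e.
have [eu ew] : u = u' /\ w = w' by have := projT1_eq e; case.
by subst; rewrite (tot4_inj e).
Qed.

Lemma ecast_tot4 (V H : Type) (F : V -> H -> H -> V -> Type) u a b w
  (e : a = b) (c : F u a a w) : ecast x (F u x x w) e c =4= c.
Proof. by case: b / e. Qed.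

(* The composite of U -> V and V -> W has top and bottom I (x) I, which is
   identified with I. *)
Definition Hcomp (U V W : vedge D) (f : cell U hI hI V) (g : cell V hI hI W) :
    cell U hI hI W :=
  ecast A (cell U A A W) (Monoid.mul1m (@hT D) hI) (hcomp f g).

Lemma HcompE U V W (f : cell U hI hI V) (g : cell V hI hI W) :
  Hcomp f g =4= hcomp f g.
Proof. exact: ecast_tot4. Qed.

Lemma hcomp_tot U V W A A' B B' U1 V1 W1 A1 A1' B1 B1'
    (f : cell U A B V) (g : cell V A' B' W)
    (f1 : @cell D U1 A1 B1 V1) (g1 : cell V1 A1' B1' W1) :
  f =4= f1 -> g =4= g1 -> hcomp f g =4= hcomp f1 g1.
Proof.
move=> ef eg.
have [eU eA eB eV] : [/\ U = U1, A = A1, B = B1 & V = V1]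
  by have := projT1_eq ef; case.
have [eA' eB' eW] : [/\ A' = A1', B' = B1' & W = W1]
  by have := projT1_eq eg; case.
by subst; rewrite (tot4_inj ef) (tot4_inj eg).
Qed.

Lemma vcomp_tot U U' W W' A B C U1 U1' W1 W1' A1 B1 C1
    (f : cell U A C W) (g : cell U' C B W')
    (f1 : @cell D U1 A1 C1 W1) (g1 : cell U1' C1 B1 W1') :
  f =4= f1 -> g =4= g1 -> vcomp f g =4= vcomp f1 g1.
Proof.
move=> ef eg.
have [eU eA eB eV] : [/\ U = U1, A = A1, C = C1 & W = W1]
  by have := projT1_eq ef; case.
have [eA' eB' eW] : [/\ U' = U1', B = B1 & W' = W1']
  by have := projT1_eq eg; case.
by subst; rewrite (tot4_inj ef) (tot4_inj eg).
Qed.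

Fact Hcomp1 U V (f : cell U hI hI V) : Hcomp (@hid D U) f = f.
Proof. by apply: tot4_inj; rewrite HcompE hcomp1c. Qed.

Fact Hcompid U V (f : cell U hI hI V) : Hcomp f (@hid D V) = f.
Proof. by apply: tot4_inj; rewrite HcompE hcompc1. Qed.

Fact HcompA U V W Z (f : cell U hI hI V) (g : cell V hI hI W)
  (h : @cell D W hI hI Z) : Hcomp (Hcomp f g) h = Hcomp f (Hcomp g h).
Proof.
apply: tot4_inj; rewrite !HcompE (hcomp_tot (HcompE f g) (erefl (tot4 h))).
by rewrite hcompA (hcomp_tot (erefl (tot4 f)) (HcompE g h)).
Qed.

Fact Htens_id U W : vcomp (@hid D U) (hid W) = hid (vT U W).
Proof. by rewrite hid_tens. Qed.

Fact Htens_comp U V W U' V' W' (f : cell U hI hI V) (g : cell V hI hI W)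
    (f' : cell U' hI hI V') (g' : @cell D V' hI hI W') :
  vcomp (Hcomp f g) (Hcomp f' g') = Hcomp (vcomp f f') (vcomp g g').
Proof.
apply: tot4_inj; rewrite (vcomp_tot (HcompE f g) (HcompE f' g')) HcompE.
by rewrite interchange.
Qed.

Fact Htens1 U V (f : cell U hI hI V) :
  tot2 (F := fun U V => cell U hI hI V) (vcomp (@hid D vI) f) = tot2 f.
Proof. by apply: tot2_tot4; rewrite hid_vid vcomp1c. Qed.

Fact Htensid U V (f : cell U hI hI V) :
  tot2 (F := fun U V => cell U hI hI V) (vcomp f (@hid D vI)) = tot2 f.
Proof. by apply: tot2_tot4; rewrite hid_vid vcompc1. Qed.

Fact HtensA U V U' V' U'' V'' (f : cell U hI hI V) (g : cell U' hI hI V')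
    (h : @cell D U'' hI hI V'') :
  tot2 (F := fun U V => cell U hI hI V) (vcomp (vcomp f g) h) =
  tot2 (vcomp f (vcomp g h)).
Proof. by apply: tot2_tot4; rewrite vcompA. Qed.

Definition horizontal_cells : strict_monoidal_category :=
  @StrictMonoidalCategory (vedge D) vI (@vT D)
    (fun U W => cell U hI hI W) (@hid D) Hcomp
    (fun U W U' W' f g => vcomp f g)
    Hcomp1 Hcompid HcompA Htens_id Htens_comp Htens1 Htensid HtensA.

End HorizontalCells.

(* The free monoid on the formal expressions A°, A•, U x W and U + W, in which
   U and W are again elements of the monoid.  It is represented by words: I is
   the empty word and U (x) W is concatenation, so the only identifications
   are associativity and unitality. *)
Inductive xatom (T : Type) : Type :=
  | XCirc of T
  | XBullet of T
  | XTimes of seq (xatom T) & seq (xatom T)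
  | XPlus of seq (xatom T) & seq (xatom T).

Notation exchange T := (seq (xatom T)).

Definition circ (T : Type) (A : T) : exchange T := [:: XCirc A].
Definition bullet (T : Type) (A : T) : exchange T := [:: XBullet A].
Definition xtimes (T : Type) (U W : exchange T) : exchange T := [:: XTimes U W].
Definition xplus (T : Type) (U W : exchange T) : exchange T := [:: XPlus U W].

Section FreeCornering.
Variable A : distributive_monoidal_category.

Implicit Types (U V W Z : exchange A) (X Y : A).

Inductive term : exchange A -> A -> A -> exchange A -> Type :=
  | Hid U : term U tunit tunit U
  | Vid X : term [::] X X [::]
  | HComp U V W X X' Y Y' :
      term U X Y V -> term V X' Y' W -> term U (tens X X') (tens Y Y') W
  | VComp U U' W W' (X Y Z : A) :
      term U X Z W -> term U' Z Y W' -> term (U ++ U') X Y (W ++ W')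
  | Box X Y : hom X Y -> term [::] X Y [::]
  | GetL X : term (circ X) tunit X [::]
  | PutR X : term [::] X tunit (circ X)
  | GetR X : term [::] tunit X (bullet X)
  | PutL X : term (bullet X) X tunit [::]
  | Proj0 U W : term (xtimes U W) tunit tunit U
  | Proj1 U W : term (xtimes U W) tunit tunit W
  | Pair U W V X Y : term V X Y U -> term V X Y W -> term V X Y (xtimes U W)
  | Inj0 U W : term U tunit tunit (xplus U W)
  | Inj1 U W : term W tunit tunit (xplus U W)
  | Sum U W V X Y : term U X Y V -> term W X Y V -> term (xplus U W) X Y V
  | Copair U W (X Y Z : A) :
      term U X Z W -> term U Y Z W -> term U (oplus X Y) Z W.

(* The least congruence containing the axioms of a double category and the
   equations on generating cells.  It is heterogeneous because the two sides of
   an equation may have boundaries that are only propositionally equal (see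
   [teq_bdry]).  The compatibility of [teq] with [Pair], [Sum] and [Copair]
   follows from their universal properties. *)
Inductive teq : forall U X Y W U' X' Y' W',
    term U X Y W -> term U' X' Y' W' -> Prop :=
  | TRefl U X Y W (a : term U X Y W) : teq a a
  | TSym U X Y W U' X' Y' W' (a : term U X Y W) (b : term U' X' Y' W') :
      teq a b -> teq b a
  | TTrans U X Y W U' X' Y' W' U'' X'' Y'' W'' (a : term U X Y W)
      (b : term U' X' Y' W') (c : term U'' X'' Y'' W'') :
      teq a b -> teq b c -> teq a c
  | THCong U V W X X' Y Y' U1 V1 W1 X1 X1' Y1 Y1'
      (a : term U X Y V) (b : term V X' Y' W)
      (a1 : term U1 X1 Y1 V1) (b1 : term V1 X1' Y1' W1) :
      teq a a1 -> teq b b1 -> teq (HComp a b) (HComp a1 b1)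
  | TVCong U U' W W' (X Y Z : A) U1 U1' W1 W1' (X1 Y1 Z1 : A)
      (a : term U X Z W) (b : term U' Z Y W')
      (a1 : term U1 X1 Z1 W1) (b1 : term U1' Z1 Y1 W1') :
      teq a a1 -> teq b b1 -> teq (VComp a b) (VComp a1 b1)

  | THAssoc U V W Z X X' X'' Y Y' Y''
      (a : term U X Y V) (b : term V X' Y' W) (c : term W X'' Y'' Z) :
      teq (HComp (HComp a b) c) (HComp a (HComp b c))
  | THUnitL U X Y W (a : term U X Y W) : teq (HComp (Hid U) a) a
  | THUnitR U X Y W (a : term U X Y W) : teq (HComp a (Hid W)) a
  | TVAssoc U U' U'' W W' W'' (X Y X' Y' : A)
      (a : term U X Y W) (b : term U' Y X' W') (c : term U'' X' Y' W'') :
      teq (VComp (VComp a b) c) (VComp a (VComp b c))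
  | TVUnitL U X Y W (a : term U X Y W) : teq (VComp (Vid X) a) a
  | TVUnitR U X Y W (a : term U X Y W) : teq (VComp a (Vid Y)) a
  | THidVid : teq (Hid [::]) (Vid tunit)
  | TVidTens X Y : teq (Vid (tens X Y)) (HComp (Vid X) (Vid Y))
  | THidTens U W : teq (Hid (U ++ W)) (VComp (Hid U) (Hid W))
  | TInterchange U V W U' V' W' (X Y Z X' Y' Z' : A)
      (a : term U X Z V) (b : term U' Z Y V')
      (c : term V X' Z' W) (d : term V' Z' Y' W') :
      teq (HComp (VComp a b) (VComp c d)) (VComp (HComp a c) (HComp b d))

  | TBoxComp (X Y Z : A) (f : hom X Y) (g : hom Y Z) :
      teq (Box (comp f g)) (VComp (Box f) (Box g))
  | TBoxId X : teq (Box (idm X)) (Vid X)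
  | TBoxTens (X Y X' Y' : A) (f : hom X Y) (g : hom X' Y') :
      teq (Box (tensm f g)) (HComp (Box f) (Box g))

  | TPutRGetL X : teq (HComp (PutR X) (GetL X)) (Vid X)
  | TGetLPutR X : teq (VComp (GetL X) (PutR X)) (Hid (circ X))
  | TGetRPutL X : teq (HComp (GetR X) (PutL X)) (Vid X)
  | TGetRPutLV X : teq (VComp (GetR X) (PutL X)) (Hid (bullet X))

  | TPair0 U W V X Y (a : term V X Y U) (b : term V X Y W) :
      teq (HComp (Pair a b) (Proj0 U W)) a
  | TPair1 U W V X Y (a : term V X Y U) (b : term V X Y W) :
      teq (HComp (Pair a b) (Proj1 U W)) b
  | TPairUniq U W V X Y (a : term V X Y U) (b : term V X Y W)
      (c : term V X Y (xtimes U W)) :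
      teq (HComp c (Proj0 U W)) a -> teq (HComp c (Proj1 U W)) b ->
      teq c (Pair a b)

  | TSum0 U W V X Y (a : term U X Y V) (b : term W X Y V) :
      teq (HComp (Inj0 U W) (Sum a b)) a
  | TSum1 U W V X Y (a : term U X Y V) (b : term W X Y V) :
      teq (HComp (Inj1 U W) (Sum a b)) b
  | TSumUniq U W V X Y (a : term U X Y V) (b : term W X Y V)
      (c : term (xplus U W) X Y V) :
      teq (HComp (Inj0 U W) c) a -> teq (HComp (Inj1 U W) c) b ->
      teq c (Sum a b)

  | TCopair0 U W (X Y Z : A) (a : term U X Z W) (b : term U Y Z W) :
      teq (VComp (Box (sigma0 X Y)) (Copair a b)) a
  | TCopair1 U W (X Y Z : A) (a : term U X Z W) (b : term U Y Z W) :
      teq (VComp (Box (sigma1 X Y)) (Copair a b)) b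
  | TCopairUniq U W (X Y Z : A) (a : term U X Z W) (b : term U Y Z W)
      (c : term U (oplus X Y) Z W) :
      teq (VComp (Box (sigma0 X Y)) c) a -> teq (VComp (Box (sigma1 X Y)) c) b ->
      teq c (Copair a b).

Lemma teq_bdry U X Y W U' X' Y' W' (a : term U X Y W) (b : term U' X' Y' W') :
  teq a b -> (U, X, Y, W) = (U', X', Y', W').
Proof.
elim=> //=.
- by move=> > _ -> _ ->.
- by move=> > _ e1 _ e2; case: e1; case: e2 => *; subst.
- by move=> > _ e1 _ e2; case: e1; case: e2 => *; subst.
- by move=> *; rewrite !Monoid.mulmA.
- by move=> *; rewrite !Monoid.mul1m.
- by move=> *; rewrite !Monoid.mulm1.
- by move=> *; rewrite !catA.
- by move=> *; rewrite !cats0.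
- by move=> *; rewrite Monoid.mul1m Monoid.mulm1.
- by move=> *; rewrite Monoid.mul1m Monoid.mulm1.
- by move=> *; rewrite !Monoid.mulm1.
- by move=> *; rewrite !Monoid.mulm1.
- by move=> *; rewrite !Monoid.mul1m.
- by move=> *; rewrite !Monoid.mul1m.
Qed.

Definition teqb U X Y W : rel {classic term U X Y W} := fun a b => `[< teq a b >].

Fact teqb_refl U X Y W : reflexive (@teqb U X Y W).
Proof. by move=> a; apply/asboolP/TRefl. Qed.

Fact teqb_sym U X Y W : symmetric (@teqb U X Y W).
Proof. by move=> a b; apply/asboolP/asboolP => /TSym. Qed.

Fact teqb_trans U X Y W : transitive (@teqb U X Y W).
Proof.
by move=> b a c /asboolP ab /asboolP bc; apply/asboolP; apply: TTrans ab bc.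
Qed.

Canonical teq_equiv U X Y W : equiv_rel {classic term U X Y W} :=
  EquivRel (@teqb U X Y W) (@teqb_refl U X Y W) (@teqb_sym U X Y W)
    (@teqb_trans U X Y W).

Local Open Scope quotient_scope.

Definition fcell U X Y W := {eq_quot (teq_equiv U X Y W)}.

Definition cls U X Y W (a : term U X Y W) : fcell U X Y W :=
  \pi_(fcell U X Y W) a.

Lemma clsP U X Y W U' X' Y' W' (a : term U X Y W) (b : term U' X' Y' W') :
  cls a =4= cls b <-> teq a b.
Proof.
split=> [e|ab].
  have [eU eX eY eW] : [/\ U = U', X = X', Y = Y' & W = W']
    by have := projT1_eq e; case.
  subst; apply/asboolP; have e1 := tot4_inj e.
  exact/(@eqmodP _ (teq_equiv U' X' Y' W')).
have [eU eX eY eW] := teq_bdry ab; subst; congr (tot4 _).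
by apply/(@eqmodP _ (teq_equiv U' X' Y' W')); apply/asboolP.
Qed.

Lemma clsP_homo U X Y W (a b : term U X Y W) : cls a = cls b <-> teq a b.
Proof. by rewrite -clsP; split=> [->|e] //; apply: tot4_inj. Qed.

Lemma cls_repr U X Y W (c : fcell U X Y W) : cls (repr c) = c.
Proof. exact: reprK. Qed.

Lemma repr_cls U X Y W (a : term U X Y W) : teq (repr (cls a)) a.
Proof. by apply/clsP_homo; rewrite cls_repr. Qed.

Definition fhcomp U V W X X' Y Y' (a : fcell U X Y V) (b : fcell V X' Y' W) :
    fcell U (tens X X') (tens Y Y') W :=
  cls (HComp (repr a) (repr b)).

Definition fvcomp U U' W W' (X Y Z : A) (a : fcell U X Z W)
    (b : fcell U' Z Y W') : fcell (U ++ U') X Y (W ++ W') :=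
  cls (VComp (repr a) (repr b)).

Lemma fhcompE U V W X X' Y Y' (a : term U X Y V) (b : term V X' Y' W) :
  fhcomp (cls a) (cls b) = cls (HComp a b).
Proof. by apply/clsP_homo/THCong; apply: repr_cls. Qed.

Lemma fvcompE U U' W W' (X Y Z : A) (a : term U X Z W) (b : term U' Z Y W') :
  fvcomp (cls a) (cls b) = cls (VComp a b).
Proof. by apply/clsP_homo/TVCong; apply: repr_cls. Qed.

Fact fhcompA U V W Z X X' X'' Y Y' Y''
    (a : fcell U X Y V) (b : fcell V X' Y' W) (c : fcell W X'' Y'' Z) :
  fhcomp (fhcomp a b) c =4= fhcomp a (fhcomp b c).
Proof.
rewrite -(cls_repr a) -(cls_repr b) -(cls_repr c) !fhcompE.
by apply/clsP/THAssoc.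
Qed.

Fact fhcomp1c U X Y W (a : fcell U X Y W) : fhcomp (cls (Hid U)) a =4= a.
Proof. by rewrite -(cls_repr a) fhcompE; apply/clsP/THUnitL. Qed.

Fact fhcompc1 U X Y W (a : fcell U X Y W) : fhcomp a (cls (Hid W)) =4= a.
Proof. by rewrite -(cls_repr a) fhcompE; apply/clsP/THUnitR. Qed.

Fact fvcompA U U' U'' W W' W'' (X Y X' Y' : A)
    (a : fcell U X Y W) (b : fcell U' Y X' W') (c : fcell U'' X' Y' W'') :
  fvcomp (fvcomp a b) c =4= fvcomp a (fvcomp b c).
Proof.
rewrite -(cls_repr a) -(cls_repr b) -(cls_repr c) !fvcompE.
by apply/clsP/TVAssoc.
Qed.

Fact fvcomp1c U X Y W (a : fcell U X Y W) : fvcomp (cls (Vid X)) a =4= a.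
Proof. by rewrite -(cls_repr a) fvcompE; apply/clsP/TVUnitL. Qed.

Fact fvcompc1 U X Y W (a : fcell U X Y W) : fvcomp a (cls (Vid Y)) =4= a.
Proof. by rewrite -(cls_repr a) fvcompE; apply/clsP/TVUnitR. Qed.

Fact fhid_vid : cls (Hid [::]) = cls (Vid tunit).
Proof. exact/clsP_homo/THidVid. Qed.

Fact fvid_tens X Y : cls (Vid (tens X Y)) = fhcomp (cls (Vid X)) (cls (Vid Y)).
Proof. by rewrite fhcompE; apply/clsP_homo/TVidTens. Qed.

Fact fhid_tens U W : cls (Hid (U ++ W)) = fvcomp (cls (Hid U)) (cls (Hid W)).
Proof. by rewrite fvcompE; apply/clsP_homo/THidTens. Qed.

Fact finterchange U V W U' V' W' (X Y Z X' Y' Z' : A)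
    (a : fcell U X Z V) (b : fcell U' Z Y V')
    (c : fcell V X' Z' W) (d : fcell V' Z' Y' W') :
  fhcomp (fvcomp a b) (fvcomp c d) = fvcomp (fhcomp a c) (fhcomp b d).
Proof.
rewrite -(cls_repr a) -(cls_repr b) -(cls_repr c) -(cls_repr d).
rewrite (fvcompE (repr a)) (fvcompE (repr c)) (fhcompE (repr a)).
by rewrite (fhcompE (repr b)) fhcompE fvcompE; apply/clsP_homo/TInterchange.
Qed.

Definition free_cornering : double_category :=
  @DoubleCategory A tunit tens (exchange A) [::] (@cat (xatom A))
    fcell fhcomp fvcomp (fun U => cls (Hid U)) (fun X => cls (Vid X))
    fhcompA fhcomp1c fhcompc1 fvcompA fvcomp1c fvcompc1
    fhid_vid fvid_tens fhid_tens finterchange.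

End FreeCornering.

(* Main.v *)
Require Import Defs.
From mathcomp Require Import all_boot.

Set Implicit Arguments.
Unset Strict Implicit.
Unset Printing Implicit Defensive.

(** Cells (I; Z; I; W) correspond to horizontal morphisms Z° -> W, by
    composing below get_L one way and after put_R the other way.  With the
    universal property of [alpha, beta] this makes (A (+) B)° a coproduct of
    A° and B° among horizontal cells.  Mirrored, cells (W; Z; I; I) correspond
    to morphisms W -> Z•, and (A (+) B)• is a product of A• and B•.  As U + W
    and U x W are themselves a coproduct and a product, all four isomorphisms
    are instances of the uniqueness of (co)products. *)

(* Products are coproducts for the reversed [hom]; abstracting over [hom] lets
   one proof serve both. *)
Section Coproducts.
Variables (T : Type) (hom : T -> T -> Type) (id : forall X, hom X X).
Variable comp : forall X Y Z, hom X Y -> hom Y Z -> hom X Z.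
Hypothesis compm1 : forall X Y (f : hom X Y), comp f (id Y) = f.
Hypothesis compA : forall X Y Z Z' (f : hom X Y) (g : hom Y Z) (h : hom Z Z'),
  comp (comp f g) h = comp f (comp g h).

Definition is_coproduct X Y P (i0 : hom X P) (i1 : hom Y P) : Prop :=
  forall Z (f : hom X Z) (g : hom Y Z),
    exists! h : hom P Z, comp i0 h = f /\ comp i1 h = g.

Definition iso X Y : Prop :=
  exists (f : hom X Y) (g : hom Y X), comp f g = id X /\ comp g f = id Y.

Lemma coproduct_ext X Y P (i0 : hom X P) (i1 : hom Y P) Z (h k : hom P Z) :
  is_coproduct i0 i1 -> comp i0 h = comp i0 k -> comp i1 h = comp i1 k -> h = k.
Proof.
by move=> /(_ Z (comp i0 k) (comp i1 k)) [l [_ l_uniq]] e0 e1;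
   rewrite -(l_uniq h) // -(l_uniq k).
Qed.

Lemma coproduct_iso X Y P Q (i0 : hom X P) (i1 : hom Y P)
    (j0 : hom X Q) (j1 : hom Y Q) :
  is_coproduct i0 i1 -> is_coproduct j0 j1 -> iso P Q.
Proof.
move=> copP copQ; have [f [[f0 f1] _]] := copP _ j0 j1.
have [g [[g0 g1] _]] := copQ _ i0 i1; exists f, g; split.
  by apply: (coproduct_ext copP); rewrite -compA ?f0 ?f1 compm1.
by apply: (coproduct_ext copQ); rewrite -compA ?g0 ?g1 compm1.
Qed.

(** [P] is also a coproduct of [X] and [YZ], where [r : hom YZ P] copairs the inclusions of [Y] and
    [Z] into [P]; [coproduct_iso] then compares it with [Q]. *)
Lemma coproductA X Y Z XY YZ P Q (i0 : hom X XY) (i1 : hom Y XY)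
    (j0 : hom Y YZ) (j1 : hom Z YZ) (p0 : hom XY P) (p1 : hom Z P)
    (q0 : hom X Q) (q1 : hom YZ Q) :
  is_coproduct i0 i1 -> is_coproduct j0 j1 -> is_coproduct p0 p1 ->
  is_coproduct q0 q1 -> iso P Q.
Proof.
move=> copXY copYZ copP; have [r [[r0 r1] _]] := copYZ _ (comp i1 p0) p1.
apply: (@coproduct_iso _ _ _ _ (comp i0 p0) r) => W f g.
(* [h] joins [f] to the [Y]-component of [g], and [k] joins [h] to the [Z]-component of [g]. *)
have [h [[h0 h1] _]] := copXY _ f (comp j0 g).
have [k [[k0 k1] _]] := copP _ h (comp j1 g).
exists k; split=> [|l [l0 l1]].
  split; first by rewrite compA k0.
  by apply: (coproduct_ext copYZ); rewrite -compA ?r0 ?r1 // compA k0.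
apply: (coproduct_ext copP).
  apply: (coproduct_ext copXY); rewrite k0 -compA; first by rewrite h0 l0.
  by rewrite h1 -l1 -r0 compA.
by rewrite k1 -l1 -compA r1.
Qed.

End Coproducts.

Section CellsOfFreeCornering.
Variable A : distributive_monoidal_category.
Notation D := (free_cornering A).
Notation H := (horizontal_cells D).
Notation I := (@tunit A).
Notation "a -|- b" := (@hcomp D _ _ _ _ _ _ _ a b) (at level 40).
Notation "a -/- b" := (@vcomp D _ _ _ _ _ _ _ a b) (at level 40).
Notation box f := (cls (Box f)).
Notation idv := (cls (Vid I)).
Implicit Types (U V W : exchange A) (X Y Z : A).

(** * Composition of cells with horizontal morphisms *)

Definition recast U W X Y X' Y' (eX : X = X') (eY : Y = Y')
    (c : @cell D U X Y W) : @cell D U X' Y' W :=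
  ecast B (@cell D U X' B W) eY (ecast B (@cell D U B Y W) eX c).

Lemma recastE U W X Y X' Y' (eX : X = X') (eY : Y = Y') (c : @cell D U X Y W) :
  recast eX eY c =4= c.
Proof. by subst. Qed.

(** The action of horizontal morphisms on the right boundary of a cell, with [X (x) I] transported
    back to [X]; [pre] is the action on the left boundary. *)
Definition post U V W X (c : @cell D U X I V) (h : @cell D V I I W) :
    @cell D U X I W :=
  recast (Monoid.mulm1 tens X) (Monoid.mul1m tens I) (c -|- h).

Definition pre U V W X (h : @cell D U I I V) (c : @cell D V X I W) :
    @cell D U X I W :=
  recast (Monoid.mul1m tens X) (Monoid.mul1m tens I) (h -|- c).

Lemma postE U V W X (c : @cell D U X I V) (h : @cell D V I I W) :
  post c h =4= c -|- h.
Proof. exact: recastE. Qed.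

Lemma preE U V W X (h : @cell D U I I V) (c : @cell D V X I W) :
  pre h c =4= h -|- c.
Proof. exact: recastE. Qed.

(** At top [I] both actions are the composition of the category; the different transports become
    invisible under [=4=]. *)
Lemma comp_post U V W (f : @cell D U I I V) (g : @cell D V I I W) :
  @Hcomp D _ _ _ f g = post f g.
Proof. by apply: tot4_inj; apply: etrans (HcompE f g) (esym (postE f g)). Qed.

Lemma comp_pre U V W (f : @cell D U I I V) (g : @cell D V I I W) :
  @Hcomp D _ _ _ f g = pre f g.
Proof. by apply: tot4_inj; apply: etrans (HcompE f g) (esym (preE f g)). Qed.

Lemma hcomp_idv U X Y (c : @cell D U X Y [::]) : c -|- idv =4= c.
Proof. by rewrite -fhid_vid; apply: (@hcompc1 D). Qed.

Lemma idv_hcomp U X Y (c : @cell D [::] X Y U) : idv -|- c =4= c.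
Proof. by rewrite -fhid_vid; apply: (@hcomp1c D). Qed.

(** Write [h] as [idv] stacked on [h] and interchange: the upper factor becomes [a -|- idv], which
    is [a] because its right boundary is [I]. *)
Lemma post_vcomp U V W W' X Y (a : @cell D U X Y [::]) (c : @cell D V Y I W)
    (h : @cell D W I I W') :
  post (a -/- c : @cell D _ _ _ W) h = a -/- post c h.
Proof.
apply: tot4_inj; rewrite postE.
have eh : h =4= idv -/- h by rewrite (@vcomp1c D).
rewrite (hcomp_tot (D := D) (erefl (tot4 (a -/- c))) eh)
  (@Defs.interchange D).
exact: (vcomp_tot (D := D) (hcomp_idv a) (esym (postE c h))).
Qed.

Lemma pre_vcomp U V W W' X Y (a : @cell D [::] X Y U) (c : @cell D W Y I V)
    (h : @cell D W' I I W) : pre h (a -/- c : @cell D W _ _ _) = a -/- pre h c.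
Proof.
apply: tot4_inj; rewrite preE.
have eh : h =4= idv -/- h by rewrite (@vcomp1c D).
rewrite (hcomp_tot (D := D) eh (erefl (tot4 (a -/- c))))
  (@Defs.interchange D).
exact: (vcomp_tot (D := D) (idv_hcomp a) (esym (preE h c))).
Qed.

(** * Corner cells give mutually inverse correspondences *)

Definition getL X : @cell D (circ X) I X [::] := cls (GetL X).
Definition putR X : @cell D [::] X I (circ X) := cls (PutR X).
Definition getR X : @cell D [::] I X (bullet X) := cls (GetR X).
Definition putL X : @cell D (bullet X) X I [::] := cls (PutL X).

(** With [putR Z] padded below by [idv], interchange puts [putR Z -|- getL Z], a vertical unit, on
    top of [idv -|- c]. *)
Lemma putRK Z W (c : @cell D [::] Z I W) :
  post (putR Z) (getL Z -/- c : @cell D (circ Z) I I W) = c.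
Proof.
apply: tot4_inj; rewrite postE.
have ep : putR Z =4= putR Z -/- idv by rewrite (@vcompc1 D).
rewrite (hcomp_tot (D := D) ep (erefl (tot4 (getL Z -/- c))))
  (@Defs.interchange D).
have e1 : putR Z -|- getL Z =4= cls (Vid Z).
  by rewrite /putR /getL /= fhcompE; apply/clsP/TPutRGetL.
by rewrite (vcomp_tot (D := D) e1 (idv_hcomp c)) (@vcomp1c D).
Qed.

(** Pulling [h] out of the stack leaves [getL Z -/- putR Z], the horizontal unit of [circ Z]. *)
Lemma getLK Z W (h : @cell D (circ Z) I I W) :
  getL Z -/- post (putR Z) h = h.
Proof.
rewrite -post_vcomp; apply: tot4_inj; rewrite postE.
have -> : getL Z -/- putR Z = @hid D (circ Z) :> @cell D (circ Z) _ _ _.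
  by rewrite /putR /getL /= fvcompE; apply/clsP_homo/TGetLPutR.
by rewrite (@hcomp1c D).
Qed.

Lemma putLK Z W (c : @cell D W Z I [::]) :
  pre (getR Z -/- c : @cell D W I I (bullet Z)) (putL Z) = c.
Proof.
apply: tot4_inj; rewrite preE.
have ep : putL Z =4= putL Z -/- idv by rewrite (@vcompc1 D).
rewrite (hcomp_tot (D := D) (erefl (tot4 (getR Z -/- c))) ep)
  (@Defs.interchange D).
have e1 : getR Z -|- putL Z =4= cls (Vid Z).
  by rewrite /putL /getR /= fhcompE; apply/clsP/TGetRPutL.
by rewrite (vcomp_tot (D := D) e1 (hcomp_idv c)) (@vcomp1c D).
Qed.

Lemma getRK Z W (h : @cell D W I I (bullet Z)) :
  getR Z -/- pre h (putL Z) = h.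
Proof.
rewrite -pre_vcomp; apply: tot4_inj; rewrite preE.
have -> : getR Z -/- putL Z = @hid D (bullet Z) :> @cell D _ _ _ (bullet Z).
  by rewrite /putL /getR /= fvcompE; apply/clsP_homo/TGetRPutLV.
by rewrite (@hcompc1 D).
Qed.

(** * Coproducts and products among horizontal cells *)

Lemma copair_cell U W X Y Z (a : @cell D U X Z W) (b : @cell D U Y Z W) :
  exists! c : @cell D U (oplus X Y) Z W,
    box (sigma0 X Y) -/- c = a /\ box (sigma1 X Y) -/- c = b.
Proof.
exists (cls (Copair (repr a) (repr b))); split=> [|c [c0 c1]].
  rewrite /= !fvcompE; split.
    by rewrite -[in RHS](cls_repr a); apply/clsP_homo/TCopair0.
  by rewrite -[in RHS](cls_repr b); apply/clsP_homo/TCopair1.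
rewrite -[RHS](cls_repr c); apply/clsP_homo/TSym.
apply: TCopairUniq; apply/clsP_homo; rewrite cls_repr.
  by rewrite -fvcompE cls_repr; apply: c0.
by rewrite -fvcompE cls_repr; apply: c1.
Qed.

Definition rev_hom (U W : H) := @hom H W U.

Definition rev_comp (U V W : H) (f : rev_hom U V) (g : rev_hom V W) :
    rev_hom U W :=
  Defs.comp g f.

Lemma xplus_coproduct U W :
  @is_coproduct H (@hom H) (@Defs.comp H) U W (xplus U W)
    (cls (Inj0 U W)) (cls (Inj1 U W)).
Proof.
move=> V f g.
exists (cls (Sum (repr (f : fcell _ _ _ _)) (repr (g : fcell _ _ _ _)))).
split=> [|h [h0 h1]].
  split; apply: tot4_inj; apply: etrans (HcompE (D := D) _ _) _;
    rewrite /= fhcompE.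
  - by rewrite -[in RHS](cls_repr f); apply/clsP/TSum0.
  - by rewrite -[in RHS](cls_repr g); apply/clsP/TSum1.
rewrite -[RHS](cls_repr h); apply/clsP_homo/TSym; apply: TSumUniq; apply/clsP.
  by rewrite -fhcompE !cls_repr -h0; apply: esym (HcompE (D := D) _ _).
by rewrite -fhcompE !cls_repr -h1; apply: esym (HcompE (D := D) _ _).
Qed.

Lemma xtimes_product U W :
  @is_coproduct H rev_hom rev_comp U W (xtimes U W)
    (cls (Proj0 U W)) (cls (Proj1 U W)).
Proof.
move=> V f g.
exists (cls (Pair (repr (f : fcell _ _ _ _)) (repr (g : fcell _ _ _ _)))).
split=> [|h [h0 h1]].
  split; apply: tot4_inj; apply: etrans (HcompE (D := D) _ _) _;
    rewrite /= fhcompE.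
  - by rewrite -[in RHS](cls_repr f); apply/clsP/TPair0.
  - by rewrite -[in RHS](cls_repr g); apply/clsP/TPair1.
rewrite -[RHS](cls_repr h); apply/clsP_homo/TSym; apply: TPairUniq; apply/clsP.
  by rewrite -fhcompE !cls_repr -h0; apply: esym (HcompE (D := D) _ _).
by rewrite -fhcompE !cls_repr -h1; apply: esym (HcompE (D := D) _ _).
Qed.

(** The action of [circ] on morphisms: receive from the left, apply [f], send to the right. *)
Definition circ_map X Y (f : hom X Y) : @hom H (circ X) (circ Y) :=
  getL X -/- (box f -/- putR Y).

(** Data in [bullet] flows from right to left, so this action is contravariant and turns the
    injections into projections. *)
Definition bullet_map X Y (f : hom X Y) : @hom H (bullet Y) (bullet X) :=
  getR X -/- (box f -/- putL Y).

(** When [h] is replaced by its cell [post (putR Y) h], precomposing with [circ_map f] amounts to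
    stacking [box f] on top. *)
Lemma circ_map_comp X Y (f : hom X Y) W (h : @hom H (circ Y) W) :
  Defs.comp (circ_map f) h = getL X -/- (box f -/- post (putR Y) h).
Proof.
apply: etrans (comp_post (circ_map f) h) _.
apply: etrans (post_vcomp (getL X) (box f -/- putR Y) h) _.
exact: (congr1 (@vcomp D (circ X) [::] [::] W I I X (getL X))
  (post_vcomp (U := [::]) (box f) (putR Y) h)).
Qed.

Lemma comp_bullet_map X Y (f : hom X Y) W (h : @hom H W (bullet Y)) :
  Defs.comp h (bullet_map f) = getR X -/- (box f -/- pre h (putL Y)).
Proof.
apply: etrans (comp_pre h (bullet_map f)) _.
apply: etrans (pre_vcomp (getR X) (box f -/- putL Y) h) _.
exact: (congr1 (@vcomp D [::] W (bullet X) [::] I I X (getR X))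
  (pre_vcomp (U := [::]) (box f) (putL Y) h)).
Qed.

Lemma circ_coproduct X Y : @is_coproduct H (@hom H) (@Defs.comp H) _ _ _
  (circ_map (sigma0 X Y)) (circ_map (sigma1 X Y)).
Proof.
move=> W f g.
(* [c] copairs the cells corresponding to [f] and [g]; the mediating morphism is the one
   corresponding to [c]. *)
have [c [[c0 c1] c_uniq]] :=
  copair_cell (post (putR X) f) (post (putR Y) g).
exists (getL (oplus X Y) -/- c); split=> [|h [h0 h1]].
  by rewrite !circ_map_comp putRK c0 c1 !getLK.
(* The cell of a competing [h] satisfies the equations that determine [c], and [getLK] recovers [h]
   from it. *)
rewrite (c_uniq (post (putR _) h)) ?getLK //.
by rewrite -h0 -h1 !circ_map_comp !putRK.
Qed.

Lemma bullet_product X Y : @is_coproduct H rev_hom rev_comp _ _ _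
  (bullet_map (sigma0 X Y)) (bullet_map (sigma1 X Y)).
Proof.
move=> W f g.
have [c [[c0 c1] c_uniq]] :=
  copair_cell (pre f (putL X)) (pre g (putL Y)).
exists (getR (oplus X Y) -/- c); split=> [|h [h0 h1]].
  by rewrite /rev_comp !comp_bullet_map putLK c0 c1 !getRK.
rewrite (c_uniq (pre h (putL _))) ?getRK //.
by rewrite -h0 -h1 /rev_comp !comp_bullet_map !putLK.
Qed.

End CellsOfFreeCornering.

Theorem lemma10 (A : distributive_monoidal_category) :
  let H := horizontal_cells (free_cornering A) in
  (forall X Y : A,
     @isomorphic H (circ (oplus X Y)) (xplus (circ X) (circ Y)) /\
     @isomorphic H (bullet (oplus X Y)) (xtimes (bullet X) (bullet Y))) /\
  (forall U V W : exchange A,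
     @isomorphic H (xtimes (xtimes U V) W) (xtimes U (xtimes V W)) /\
     @isomorphic H (xplus (xplus U V) W) (xplus U (xplus V W))).
Proof.
move=> H.
have iso_hom (U W : H) : iso (@idm H) (@Defs.comp H) U W -> isomorphic U W.
  by [].
have compA_rev U V W Z (f : @rev_hom A U V) (g : rev_hom V W)
    (h : rev_hom W Z) :
    rev_comp (rev_comp f g) h = rev_comp f (rev_comp g h).
  by rewrite /rev_comp Defs.compA.
have iso_rev (U W : H) :
    iso (@idm H : forall V, rev_hom V V) (@rev_comp A) U W -> isomorphic U W.
  (* Reversal exchanges the two directions of an isomorphism. *)
  by move=> [f [g [fg gf]]]; exists g, f.
split=> [X Y|U V W]; split.
- apply: iso_hom; apply: (coproduct_iso _ (@Defs.compA H)
    (@circ_coproduct A X Y) (@xplus_coproduct A _ _)).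
  exact: (@compm1 H).
- apply: iso_rev; apply: (coproduct_iso _ compA_rev
    (@bullet_product A X Y) (@xtimes_product A _ _)).
  (* Right unitality of [rev_comp] is left unitality of [comp]. *)
  by move=> Y0 X0 f; apply: comp1m.
- apply: iso_rev; apply: (coproductA _ compA_rev (@xtimes_product A U V)
    (@xtimes_product A V W) (@xtimes_product A _ _) (@xtimes_product A _ _)).
  by move=> Y0 X0 f; apply: comp1m.
- apply: iso_hom; apply: (coproductA _ (@Defs.compA H) (@xplus_coproduct A U V)
    (@xplus_coproduct A V W) (@xplus_coproduct A _ _) (@xplus_coproduct A _ _)).
  exact: (@compm1 H).
Qed.
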